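(* For all $m\in\mathbb{Z}\setminus\{0\}$ and $\xi\in\mathbb{Z}_m$, the marked group $\overline{BS}(m,\xi)$ admits the presentation $\langle a,b\mid \mathcal{R}_{m,\xi}\rangle$, where $$\mathcal{R}_{m,\xi}=\big\{\, w\bar w \;:\; w=ab^{\alpha_1}\cdots ab^{\alpha_k}a^{-1}b^{\alpha_{k+1}}\cdots a^{-1}b^{\alpha_{2k}} \text{ with } k\in\mathbb{N}^*,\ \alpha_i\in\mathbb{Z}\ (i=1,\dots,2k) \text{ and } w\cdot v_0=v_0 \,\big\}.$$
   Context: A marked group on $k$ generators is a pair $(G,S)$ with $S=(s_1,\dots,s_k)\in G^k$ generating $G$, considered up to isomorphisms respecting the markings. $\mathcal{G}_k$ is the set of marked groups on $k$ generators with the ultrametric $d((G_1,S_1),(G_2,S_2))=e^{-\lambda}$, where $\lambda$ is the word length of a shortest element of the free group $\mathbb{F}_k$ that is trivial in one group and not in the other. For $m,n\in\mathbb{Z}\setminus\{0\}$, $BS(m,n)=\langle a,b\mid ab^ma^{-1}=b^n\rangle$, marked by $(a,b)$. The ring of $m$-adic integers is $\mathbb{Z}_m=\varprojlim_h \mathbb{Z}/m^h\mathbb{Z}$ (the zero ring if $|m|=1$). For $\xi\in\mathbb{Z}_m$, $\overline{BS}(m,\xi)=\lim_{n\to\infty}BS(m,\xi_n)$ in $\mathcal{G}_2$, where $(\xi_n)_n$ is any sequence of non-zero rational integers with $|\xi_n|\to\infty$ and $\xi_n\to\xi$ in $\mathbb{Z}_m$ (it is known that this limit exists and does not depend on the choice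 of $(\xi_n)_n$); it is marked by $(a,b)$. Let $\mathbb{F}_2$ be the free group on $a,b$, and let $w\mapsto\bar w$ be the endomorphism of $\mathbb{F}_2$ with $\bar a=a$, $\bar b=b^{-1}$. The tree $X=X_{m,\xi}$: fix a sequence $(\xi_n)_n$ of non-zero rational integers with $|\xi_n|\to\infty$ and $\xi_n\to\xi$ in $\mathbb{Z}_m$. Let $H_n$ and $H_n^m$ be the subgroups of $BS(m,\xi_n)$ generated by $b$ and by $b^m$, respectively. Let $\sim$ denote the equivalence of sequences that agree for all $n$ large enough. The vertices of $X$ are the $\sim$-classes of sequences $(wH_n)_n\in\prod_n BS(m,\xi_n)/H_n$ with $w\in\mathbb{F}_2$; the oriented edges are the $\sim$-classes of sequences $(wH_n^m)_n\in\prod_n BS(m,\xi_n)/H_n^m$ with $w\in\mathbb{F}_2$; the edge $(wH_n^m)_n$ has origin $(wH_n)_n$ and terminal vertex $(wa^{-1}H_n)_n$. $\mathbb{F}_2$ acts on $X$ by left multiplication. Up to equivariant isomorphism $X$ does not depend on $(\xi_n)_n$. The favoured vertex is $v_0=(H_n)_n$; thus $w\cdot v_0=v_0$ means that $w$ represents a power of $b$ in $BS(m,\xi_n)$ for all but finitely many $n$. That the marked group admits this presentation means that the kernel of the canonical map $\mathbb{F}_2\to\overline{BS}(m,\xi)$ is the normal closure of $\mathcal{R}_{m,\xi}$. *)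

(* Defs.v *)
From HB Require Import structures.
From mathcomp Require Import all_boot all_order all_algebra.
From mathcomp Require Import all_classical all_reals all_analysis.

Set Implicit Arguments.
Unset Strict Implicit.
Unset Printing Implicit Defensive.

Import Order.TTheory GRing.Theory Num.Theory.

Local Open Scope classical_set_scope.
Local Open Scope group_scope.

Definition expgz (G : groupType) (x : G) (z : int) : G :=
  match z with Posz n => x ^+ n | Negz n => x ^- n.+1 end.
Notation "x ^z z" := (expgz x z)
  (at level 29, z at level 28, left associativity) : group_scope.

Definition is_subgroup (G : groupType) (H : set G) : Prop :=
  [/\ H 1, forall x y, H x -> H y -> H (x * y) & forall x, H x -> H x^-1].

Definition is_normal (G : groupType) (H : set G) : Prop :=
  is_subgroup H /\ forall x y, H x -> H (y * x * y^-1).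

Definition generated (G : groupType) (A : set G) : set G :=
  smallest (@is_subgroup G) A.

Definition normal_closure (G : groupType) (A : set G) : set G :=
  smallest (@is_normal G) A.

Definition left_coset (G : groupType) (x : G) (H : set G) : set G :=
  [set x * h | h in H].

Section Subgroups.
Variable G : groupType.

Lemma generated_subgroup (A : set G) : is_subgroup (generated A).
Proof.
split=> [M [[]]//|x y Hx Hy M MA|x Hx M MA].
  by have [[_ MM _] _] := MA; apply: MM; [apply: Hx|apply: Hy].
by have [[_ _ MV] _] := MA; apply: MV; apply: Hx.
Qed.

Lemma normal_closure_normal (A : set G) : is_normal (normal_closure A).
Proof.
split=> [|x y Hx M MA]; last first.
  by have [[_ MJ] _] := MA; apply: MJ; apply: Hx.
split=> [M [[[]]]//|x y Hx Hy M MA|x Hx M MA].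
  by have [[[_ MM _] _] _] := MA; apply: MM; [apply: Hx|apply: Hy].
by have [[[_ _ MV] _] _] := MA; apply: MV; apply: Hx.
Qed.

Lemma sub_generated (A : set G) : A `<=` generated A.
Proof. by move=> x Ax M [_]; apply. Qed.

End Subgroups.

(* Elements of the free group are reduced words; the letter (s, false) stands
   for the generator s and (s, true) for its inverse. *)
Section FreeGroup.
Variable S : choiceType.

Definition letter : Type := (S * bool)%type.
HB.instance Definition _ := Choice.on letter.

Implicit Types (x : letter) (u v w : seq letter).

Definition letter_inv x : letter := (x.1, ~~ x.2).

Definition reduced w : bool := sorted (fun x y => y != letter_inv x) w.

Definition push x w : seq letter :=
  if w is y :: w' then if y == letter_inv x then w' else x :: w else [:: x].

Definition word_mul u v : seq letter := foldr push v u.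

Definition word_inv w : seq letter := rev (map letter_inv w).

Lemma letter_invK : involutive letter_inv.
Proof. by case=> s b; rewrite /letter_inv /= negbK. Qed.

Lemma reduced_behead x w : reduced (x :: w) -> reduced w.
Proof. exact: path_sorted. Qed.

Lemma reduced_push x w : reduced w -> reduced (push x w).
Proof.
case: w => [//|y w] /= yw; case: ifPn => [_|nyx]; first exact: path_sorted yw.
by rewrite /= nyx.
Qed.

Lemma push_reduced x w : reduced (x :: w) -> push x w = x :: w.
Proof. by case: w => [//|y w] /= /andP[/negbTE->]. Qed.

Lemma pushK x w : reduced w -> push x (push (letter_inv x) w) = w.
Proof.
case: w => [|y w] yw; first by rewrite /= eqxx.
rewrite [push (letter_inv x) _]/= letter_invK; case: eqP => [yx|_].
  by rewrite -yx push_reduced.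
by rewrite /= eqxx.
Qed.

Lemma reduced_mul u v : reduced v -> reduced (word_mul u v).
Proof. by move=> rv; elim: u => //= x u; apply: reduced_push. Qed.

Lemma word_mul_cat u1 u2 v : word_mul (u1 ++ u2) v = word_mul u1 (word_mul u2 v).
Proof. exact: foldr_cat. Qed.

Lemma word_mul0 w : reduced w -> word_mul w [::] = w.
Proof.
elim: w => //= x w IH xw.
by rewrite IH ?push_reduced //; apply: path_sorted xw.
Qed.

Lemma word_mul_push x u v :
  reduced v -> word_mul (push x u) v = push x (word_mul u v).
Proof.
move=> rv; case: u => [//|y u]; rewrite /push -/(push _).
case: ifPn => [/eqP->|//]; rewrite [word_mul (_ :: _) _]/=.
by rewrite -/(push x _) pushK // reduced_mul.
Qed.

Lemma word_mulA u v w :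
  reduced w -> word_mul u (word_mul v w) = word_mul (word_mul u v) w.
Proof. by move=> rw; elim: u => //= x u ->; rewrite word_mul_push. Qed.

Lemma word_mulVK u v : reduced v -> word_mul u (word_mul (word_inv u) v) = v.
Proof.
elim: u v => // x u IH v rv.
by rewrite /word_inv map_cons rev_cons -cats1 word_mul_cat /= IH ?pushK //=;
  apply: reduced_push.
Qed.

Lemma word_invK : involutive word_inv.
Proof. by move=> u; rewrite /word_inv map_rev revK (mapK letter_invK). Qed.

Lemma reduced_inv w : reduced w -> reduced (word_inv w).
Proof.
rewrite /reduced /word_inv rev_sorted sorted_map => /=.
apply: sub_sorted => x y; apply: contraNN => /eqP ->.
by rewrite letter_invK.
Qed.

Record free_group : Type :=
  FreeElt { word : seq letter; word_reduced : reduced word }.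

HB.instance Definition _ := [isSub for word].
HB.instance Definition _ := [Choice of free_group by <:].

Definition free_one := @FreeElt [::] isT.
Definition free_mul (f g : free_group) :=
  FreeElt (reduced_mul (word f) (word_reduced g)).
Definition free_inv (f : free_group) := FreeElt (reduced_inv (word_reduced f)).

Lemma free_mulA : associative free_mul.
Proof. by move=> f g h; apply: val_inj; apply: word_mulA; case: h. Qed.
Lemma free_mul1 : left_id free_one free_mul.
Proof. by move=> f; apply: val_inj. Qed.
Lemma free_mulr1 : right_id free_one free_mul.
Proof. by case=> w rw; apply: val_inj; apply: word_mul0. Qed.
Lemma free_mulrV : right_inverse free_one free_inv free_mul.
Proof.
case=> w rw; apply: val_inj => /=.
by rewrite -[word_inv w]word_mul0 ?word_mulVK // reduced_inv.
Qed.
Lemma free_mulV : left_inverse free_one free_inv free_mul.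
Proof.
case=> w rw; apply: val_inj => /=.
by rewrite -{2}[w]word_invK -[word_inv (word_inv w)]word_mul0 ?word_mulVK //
  !reduced_inv.
Qed.

HB.instance Definition _ := isGroup.Build free_group
  free_mulA free_mul1 free_mulr1 free_mulV free_mulrV.

Definition free_gen (s : S) : free_group := @FreeElt [:: (s, false)] isT.

(* The homomorphism extending g : S -> G. *)
Definition letter_eval (G : groupType) (g : S -> G) x : G :=
  if x.2 then (g x.1)^-1 else g x.1.
Definition free_eval (G : groupType) (g : S -> G) (f : free_group) : G :=
  \prod_(x <- word f) letter_eval g x.

Lemma free_evalM (G : groupType) (g : S -> G) f1 f2 :
  free_eval g (f1 * f2) = free_eval g f1 * free_eval g f2.
Proof.
rewrite /free_eval -[word (f1 * f2)]/(word_mul (word f1) (word f2)).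
elim: (word f1) => [|x u IH] /=; first by rewrite big_nil mul1g.
rewrite big_cons -mulgA -IH; case: (word_mul _ _) => [|y v].
  by rewrite /= big_seq1 big_nil mulg1.
rewrite /=; case: eqP => [->|_]; last by rewrite [LHS]big_cons.
rewrite big_cons mulgA -[LHS]mul1g; congr (_ * _).
by case: x => s [] /=; rewrite /letter_eval /= ?mulVg ?mulgV.
Qed.

Lemma free_eval_gen (G : groupType) (g : S -> G) s :
  free_eval g (free_gen s) = g s.
Proof. by rewrite /free_eval big_seq1. Qed.

Lemma free_eval1 (G : groupType) (g : S -> G) : free_eval g 1 = 1.
Proof. by rewrite /free_eval big_nil. Qed.

Lemma free_generated : generated (range free_gen) = [set: free_group].
Proof.
rewrite eqEsubset; split=> // -[w rw] _.
have [gen1 genM genV] := generated_subgroup (range free_gen).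
have genS s : generated (range free_gen) (free_gen s).
  by apply: sub_generated; exists s.
elim: w rw => [rw|[s b] w IH rw]; first by rewrite [FreeElt _](_ : _ = 1) //;
  apply: val_inj.
have rw' : reduced w := path_sorted rw.
have -> : FreeElt rw = (if b then (free_gen s)^-1 else free_gen s) * FreeElt rw'.
  by apply: val_inj; case: b rw => rw /=; rewrite -[LHS]push_reduced.
by apply: genM; [case: b {rw} => //; apply: genV|apply: IH].
Qed.

End FreeGroup.

Section QuotientGroup.
Local Open Scope quotient_scope.
Variables (G : groupType) (N : set G) (nN : is_normal N).

Definition coset_rel : rel G := fun x y => `[< N (x^-1 * y) >].

Lemma coset_rel_equiv : equiv_class_of coset_rel.
Proof.
have [[N1 NM NV] _] := nN; split.
- by move=> x; apply/asboolP; rewrite mulVg.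
- move=> x y; apply/asboolP/asboolP => /NV; rewrite invgM invgK //.
- move=> y x z /asboolP xy /asboolP yz; apply/asboolP.
  by have := NM _ _ xy yz; rewrite -mulgA mulVKg.
Qed.

Canonical coset_equiv := EquivRelPack coset_rel_equiv.

Definition quotient_group : Type := {eq_quot coset_rel}.
HB.instance Definition _ := Choice.on quotient_group.
HB.instance Definition _ := EqQuotient.on quotient_group.

Definition qpi (x : G) : quotient_group := \pi x.

Lemma qpi_eq x y : (qpi x = qpi y) <-> N (x^-1 * y).
Proof.
split=> [/eqmodP/asboolP//|xy]; apply/eqmodP; exact/asboolP.
Qed.

Lemma qpi_surj (q : quotient_group) : exists x, q = qpi x.
Proof. by exists (repr q); rewrite /qpi reprK. Qed.

Definition qone : quotient_group := qpi 1.
Definition qmul (p q : quotient_group) : quotient_group :=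
  qpi (repr p * repr q).
Definition qinv (p : quotient_group) : quotient_group := qpi (repr p)^-1.

Lemma N_repr x : N ((repr (qpi x))^-1 * x).
Proof. by apply/qpi_eq; rewrite /qpi reprK. Qed.

Lemma qmulE x y : qmul (qpi x) (qpi y) = qpi (x * y).
Proof.
have [[N1 NM NV] NJ] := nN; apply/qpi_eq.
have := NM _ _ (NJ _ (repr (qpi y))^-1 (N_repr x)) (N_repr y).
by rewrite invgM invgK -!mulgA mulVKg.
Qed.

Lemma qinvE x : qinv (qpi x) = qpi x^-1.
Proof.
have [[N1 NM NV] NJ] := nN; apply/qpi_eq; rewrite invgK.
have := NJ _ x (NV _ (N_repr x)).
by rewrite invgM invgK mulgA mulgV mul1g.
Qed.

Lemma qmulA : associative qmul.
Proof.
move=> p q r; have [x ->] := qpi_surj p; have [y ->] := qpi_surj q.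
by have [z ->] := qpi_surj r; rewrite !qmulE mulgA.
Qed.
Lemma qmul1 : left_id qone qmul.
Proof. by move=> p; have [x ->] := qpi_surj p; rewrite qmulE mul1g. Qed.
Lemma qmulr1 : right_id qone qmul.
Proof. by move=> p; have [x ->] := qpi_surj p; rewrite qmulE mulg1. Qed.
Lemma qmulV : left_inverse qone qinv qmul.
Proof. by move=> p; have [x ->] := qpi_surj p; rewrite qinvE qmulE mulVg. Qed.
Lemma qmulrV : right_inverse qone qinv qmul.
Proof. by move=> p; have [x ->] := qpi_surj p; rewrite qinvE qmulE mulgV. Qed.

HB.instance Definition _ := isGroup.Build quotient_group
  qmulA qmul1 qmulr1 qmulV qmulrV.

Lemma qpiM x y : qpi (x * y) = qpi x * qpi y.
Proof. by rewrite -[RHS]/(qmul _ _) qmulE. Qed.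

Lemma qpiV x : qpi x^-1 = (qpi x)^-1.
Proof. by rewrite -[RHS]/(qinv _) qinvE. Qed.

Lemma qpi_eq1 x : (qpi x = 1) <-> N x.
Proof.
by split=> [/esym/qpi_eq|Nx]; [|apply/esym/qpi_eq]; rewrite invg1 mul1g.
Qed.

Lemma quotient_generated (A : set G) :
  generated A = [set: G] -> generated (qpi @` A) = [set: quotient_group].
Proof.
move=> genA; rewrite eqEsubset; split=> // p _; have [x ->] := qpi_surj p.
have [g1 gM gV] := generated_subgroup (qpi @` A).
have: generated A x by rewrite genA.
move=> /(_ (qpi @^-1` generated (qpi @` A))); apply; split; last first.
  by move=> y Ay /=; apply: sub_generated; exists y.
split=> [//|y z|y] /=; first by rewrite qpiM; apply: gM.
by rewrite qpiV; apply: gV.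
Qed.

End QuotientGroup.

(* Marked groups are not quotiented by marked isomorphism: mg_dist below is a
   pseudometric, which vanishes exactly on isomorphic marked groups. *)
Record markedGroup (k : nat) := MarkedGroup {
  mg_group :> groupType;
  mg_gen : 'I_k -> mg_group;
  mg_generates : generated (range mg_gen) = [set: mg_group] }.

Notation Free k := (free_group 'I_k).

Definition mg_eval k (G : markedGroup k) (w : Free k) : G :=
  free_eval (@mg_gen k G) w.

Definition mg_kernel k (G : markedGroup k) : set (Free k) :=
  [set w | mg_eval G w = 1].

Definition admits_presentation k (G : markedGroup k) (A : set (Free k)) : Prop :=
  mg_kernel G = normal_closure A.

Section Presented.
Variables (k : nat) (A : set (Free k)).
Let N := normal_closure_normal A.

Lemma presented_generates :
  generated (range (fun i : 'I_k => qpi N (free_gen i))) = [set: _].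
Proof.
rewrite -(quotient_generated N (free_generated _)); congr generated.
by rewrite -image_comp.
Qed.

Definition presented : markedGroup k := MarkedGroup presented_generates.

End Presented.

Section Distance.
Variables (R : realType) (k : nat).

Definition mg_differ (G1 G2 : markedGroup k) (n : nat) : Prop :=
  exists2 w : Free k, size (word w) = n & ~ (mg_kernel G1 w <-> mg_kernel G2 w).

Definition mg_dist (G1 G2 : markedGroup k) : R :=
  if pselect (exists n, `[< mg_differ G1 G2 n >]) is left h
  then expR (- (ex_minn h)%:R)%R else 0%R.

Definition mg_cvg (u : nat -> markedGroup k) (G : markedGroup k) : Prop :=
  mg_dist (u n) G @[n --> \oo] --> 0%R.

End Distance.

Definition ga : Free 2 := free_gen ord0.
Definition gb : Free 2 := free_gen ord_max.

Definition BS (m n : int) : markedGroup 2 :=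
  presented [set ga * gb ^z m * ga^-1 * (gb ^z n)^-1].

Local Open Scope ring_scope.

(* Elements of Z/m^h are represented by their canonical residues; for
   `|m| = 1 the only element is the zero sequence.  Only m != 0 is meaningful,
   since (z %% 0)%Z = z. *)
Record madic (m : int) := Madic {
  madic_coord :> nat -> int;
  madic_compat : forall h, madic_coord h = (madic_coord h.+1 %% m ^+ h)%Z }.

Lemma int_madic_compat (m z : int) (h : nat) :
  (z %% m ^+ h)%Z = ((z %% m ^+ h.+1)%Z %% m ^+ h)%Z.
Proof.
by rewrite {1}(divz_eq z (m ^+ h.+1)) exprS mulrA modzMDl.
Qed.

Definition int_madic (m z : int) : madic m := Madic (int_madic_compat m z).

(* Convergence in the inverse limit of the discrete rings Z/m^h. *)
Definition madic_cvg (m : int) (u : nat -> madic m) (xi : madic m) : Prop :=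
  forall h, \forall n \near \oo, u n h = xi h.

Definition admissible (m : int) (xi : madic m) (x : nat -> int) : Prop :=
  [/\ forall n, x n != 0,
      absz (x n) @[n --> \oo] --> \oo
    & madic_cvg (fun n => int_madic m (x n)) xi].

Local Open Scope group_scope.

Definition is_BS_limit (R : realType) (m : int) (xi : madic m)
    (G : markedGroup 2) : Prop :=
  forall x, admissible xi x -> mg_cvg R (fun n => BS m (x n)) G.

(* A total limit operator: the default value (the free group) is only used if
   there is no limit, which does not happen for m != 0.  The limit is unique
   up to isomorphism of marked groups. *)
Definition BSbar (R : realType) (m : int) (xi : madic m) : markedGroup 2 :=
  if pselect (exists G, is_BS_limit R xi G) is left h then projT1 (cid h)
  else presented set0.

Definition bar : Free 2 -> Free 2 :=
  free_eval (fun i : 'I_2 => if i == ord0 then ga else gb^-1).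

(* The vertex set of the tree built from the sequence x; the edges play no role
   in the relators.  A vertex is an equivalence class, i.e. a set, of sequences
   of cosets. *)
Section Tree.
Variables (m : int) (x : nat -> int).

Definition BSseq (n : nat) : markedGroup 2 := BS m (x n).

Definition Hsub (n : nat) : set (BSseq n) := generated [set mg_eval (BSseq n) gb].

Definition set_seq : Type := forall n, set (BSseq n).

Definition coset_class (s : set_seq) : set set_seq :=
  [set t : set_seq | (forall n, exists g, t n = left_coset g (@Hsub n))
                     /\ \forall n \near \oo, t n = s n].

Definition tree_vertex (w : Free 2) : set set_seq :=
  coset_class (fun n => left_coset (mg_eval (BSseq n) w) (@Hsub n)).

Definition vertices : set (set set_seq) := range tree_vertex.

Definition translate (w : Free 2) (t : set_seq) : set_seq :=
  fun n => left_coset (mg_eval (BSseq n) w) (t n).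

Definition tree_act (w : Free 2) (V : set set_seq) : set set_seq :=
  [set translate w t | t in V].

Definition v0 : set set_seq := tree_vertex 1.

Lemma mg_evalM k (G : markedGroup k) (u w : Free k) :
  mg_eval G (u * w) = mg_eval G u * mg_eval G w.
Proof. exact: free_evalM. Qed.

Lemma left_cosetM (G : groupType) (g h : G) (H : set G) :
  left_coset g (left_coset h H) = left_coset (g * h) H.
Proof.
rewrite /left_coset image_comp; apply: eq_imagel => y _ /=.
by rewrite mulgA.
Qed.

Lemma left_coset1 (G : groupType) (H : set G) : left_coset 1 H = H.
Proof. by rewrite -[RHS]image_id; apply: eq_imagel => y _; rewrite mul1g. Qed.

Lemma tree_act_vertex (w v : Free 2) :
  tree_act w (tree_vertex v) = tree_vertex (w * v).
Proof.
rewrite eqEsubset; split=> [_ [t [tH tv] <-]|t [tH tv]]; last first.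
  exists (fun n => left_coset (mg_eval (BSseq n) w)^-1 (t n)); last first.
    by apply: functional_extensionality_dep => n;
      rewrite /translate left_cosetM mulgV left_coset1.
  split=> [n|]; first by have [g ->] := tH n; rewrite left_cosetM; eexists.
  by near=> n; rewrite (near tv n) // left_cosetM mg_evalM mulKg.
rewrite /translate; split=> [n|].
  by have [g ->] := tH n; rewrite left_cosetM; eexists.
by near=> n; rewrite (near tv n) // left_cosetM mg_evalM.
Unshelve. all: by end_near.
Qed.

Lemma tree_act_v0 (w : Free 2) :
  (tree_act w v0 = v0) <-> \forall n \near \oo, @Hsub n (mg_eval (BSseq n) w).
Proof.
rewrite tree_act_vertex mulg1.
have H1 n : [/\ @Hsub n 1, forall g h, @Hsub n g -> @Hsub n h -> @Hsub n (g * h)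
  & forall g, @Hsub n g -> @Hsub n g^-1] := generated_subgroup _.
have ev1 n : left_coset (mg_eval (BSseq n) 1) (@Hsub n) = @Hsub n.
  by rewrite /mg_eval free_eval1 left_coset1.
split=> [wv|wH].
  have: v0 (fun n => left_coset (mg_eval (BSseq n) w) (@Hsub n)).
    rewrite -wv; split=> [n|]; first by eexists.
    by near=> n.
  case=> _ wE; near=> n.
  rewrite -(ev1 n) -(near wE n) //.
  by have [H1n _ _] := H1 n; exists 1 => //; rewrite mulg1.
have E : \forall n \near \oo,
    left_coset (mg_eval (BSseq n) w) (@Hsub n) = @Hsub n.
  near=> n; have [_ HM HV] := H1 n.
  have Hw : @Hsub n (mg_eval (BSseq n) w) by near: n.
  rewrite eqEsubset; split=> [_ [h Hh <-]|h Hh]; first exact: HM.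
  exists ((mg_eval (BSseq n) w)^-1 * h); last by rewrite mulVKg.
  by apply: HM => //; apply: HV.
by rewrite eqEsubset; split=> t [tH tE]; split=> //; near=> n;
  rewrite (near tE n) // (near E n) // ev1.
Unshelve. all: by end_near.
Qed.

End Tree.

Arguments v0 : clear implicits.

Definition updown (k : nat) (alpha : nat -> int) : Free 2 :=
  (\prod_(1 <= i < k.+1) (ga * gb ^z alpha i)) *
  (\prod_(k.+1 <= i < (2 * k).+1) (ga^-1 * gb ^z alpha i)).

(* The tree is built from the sequence x of rational integers tending to xi. *)
Definition relators (m : int) (x : nat -> int) : set (Free 2) :=
  [set w * bar w | w in
    [set w | (exists k alpha, (0 < k)%N /\ w = updown k alpha)
             /\ tree_act w (v0 m x) = v0 m x]].

(* Main.v *)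
(* By Britton's lemma, an element of BS(m, x_n) is rewritten by moving powers of
   b^m to the left of a and powers of b^(x_n) to the left of a^-1. Starting from
   a fixed word and letting n vary, the exponents of b that occur are values at
   t = x_n / m of polynomials with integer coefficients, subject to integrality
   conditions on their Horner partial values. As x_n converges m-adically and
   |x_n| tends to infinity, the divisibility of such an exponent by m or by x_n,
   and its vanishing, are decided for large n, so the rewriting is uniform in n.

   A polynomial P = c_0 + .. + c_d t^d is realised in the free group by
   a^(d+1) a^-1 b^(c_d) .. a^-1 b^(c_0), which fixes v0, and the relators
   w bar(w) for P and P + z say that this element commutes with b^z. This makes
   P |-> b^P additive modulo the relators, so that every step of the rewriting is
   a consequence of the relators. Hence a word which is not a product of
   conjugates of relators has an irreducible form that is nontrivial in
   BS(m, x_n) for all large n. Interleaving two admissible sequences shows that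
   the normal closure depends on xi only, hence that the limit exists. *)
Require Import Defs.
From mathcomp Require Import all_boot all_order all_algebra.
From mathcomp Require Import all_classical all_reals all_analysis.
From mathcomp Require Import zify ring.

Set Implicit Arguments.
Unset Strict Implicit.
Unset Printing Implicit Defensive.

Import Order.TTheory GRing.Theory Num.Theory.

Local Open Scope classical_set_scope.

(** * Homomorphisms and integer powers in groups *)

Section Morphisms.
Local Open Scope group_scope.
Variables (G H : groupType) (f : G -> H).
Hypothesis fM : {morph f : u v / u * v}.

Lemma morph_one : f 1 = 1.
Proof. by apply: (mulgI (f 1)); rewrite -fM !mulg1. Qed.

Lemma morph_inv u : f u^-1 = (f u)^-1.
Proof. by apply: (mulgI (f u)); rewrite -fM !mulgV morph_one. Qed.

Lemma kernel_normal : is_normal [set u | f u = 1].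
Proof.
split=> [|u v /= fu]; last by rewrite !fM fu mulg1 morph_inv mulgV.
split=> /= [|u v fu fv|u fu]; first exact: morph_one.
  by rewrite fM fu fv mulg1.
by rewrite morph_inv fu invg1.
Qed.

End Morphisms.

Section IntegerPowers.
Local Open Scope group_scope.
Variable G : groupType.
Implicit Types (x : G) (y z : int).

Lemma expgz_succ x z : x ^z (z + 1)%R = x ^z z * x.
Proof.
case: z => [n|n]; first by rewrite -PoszD addn1 /= expgSr.
case: n => [|n]; first by rewrite /= expg1 mulVg.
rewrite [(Negz n.+1 + 1)%R](_ : _ = Negz n); last by lia.
by rewrite /= [x ^+ n.+2]expgS invgM mulgVK.
Qed.

Lemma expgzD x y z : x ^z (y + z)%R = x ^z y * x ^z z.
Proof.
have S t k : x ^z (t + k%:Z)%R = x ^z t * x ^+ k.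
  elim: k => [|k IH]; first by rewrite addr0 mulg1.
  rewrite (_ : (t + k.+1%:Z)%R = (t + k%:Z + 1)%R); last by lia.
  by rewrite expgz_succ IH expgSr mulgA.
case: z => k //=; apply: (mulIg (x ^+ k.+1)); rewrite mulgVK -S.
by congr (_ ^z _); lia.
Qed.

Lemma expgzN x z : x ^z (- z)%R = (x ^z z)^-1.
Proof.
by apply: (mulIg (x ^z z)); rewrite mulVg -expgzD addNr.
Qed.

Lemma conj_expgz x g z : g * x ^z z * g^-1 = (g * x * g^-1) ^z z.
Proof.
have S k : g * x ^+ k * g^-1 = (g * x * g^-1) ^+ k.
  elim: k => [|k IH]; first by rewrite mulg1 mulgV.
  by rewrite !expgSr -IH !mulgA mulgVK.
by case: z => k //=; rewrite -S !invgM invgK mulgA.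
Qed.

Lemma expgzM x y z : x ^z (y * z)%R = (x ^z y) ^z z.
Proof.
have S k : x ^z (y * k%:Z)%R = (x ^z y) ^+ k.
  elim: k => [|k IH]; first by rewrite mulr0.
  by rewrite expgSr -IH -expgzD; congr (_ ^z _); lia.
case: z => k //=; rewrite -S -expgzN; congr (_ ^z _); lia.
Qed.

Lemma expgz_morph (H : groupType) (f : G -> H) x z :
  {morph f : u v / u * v} -> f (x ^z z) = f x ^z z.
Proof.
move=> fM.
have fX k : f (x ^+ k) = f x ^+ k.
  by elim: k => [|k IH]; rewrite ?morph_one // !expgSr fM IH.
by case: z => k /=; rewrite ?morph_inv // fX.
Qed.

Lemma generated_set1 x : generated [set x] `<=` range (fun z => x ^z z).
Proof.
move=> g; apply; split; last by move=> _ ->; exists 1%R.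
split=> [|_ _ [y _ <-] [z _ <-]|_ [y _ <-]]; first by exists 0%R.
  by exists (y + z)%R => //; rewrite expgzD.
by exists (- y)%R => //; rewrite expgzN.
Qed.

End IntegerPowers.

Section Homomorphisms.
Local Open Scope group_scope.

Lemma normal_closure_min (G : groupType) (A M : set G) :
  is_normal M -> A `<=` M -> normal_closure A `<=` M.
Proof. by move=> nM AM u; apply. Qed.

Lemma sub_normal_closure (G : groupType) (A : set G) : A `<=` normal_closure A.
Proof. by move=> u Au M [_]; apply. Qed.

Lemma free_eval_unique (S : choiceType) (G : groupType) (f : free_group S -> G) :
  {morph f : u v / u * v} -> f =1 free_eval (fun s => f (free_gen s)).
Proof.
move=> fM w; set g := free_eval _.
have gM : {morph g : u v / u * v} by move=> u v; exact: free_evalM.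
have : generated (range (@free_gen S)) w by rewrite free_generated.
move=> /(_ [set u | f u = g u]); apply; split; last first.
  by move=> _ [s _ <-] /=; rewrite /g free_eval_gen.
split=> /= [|u v fu fv|u fu]; first by rewrite !morph_one.
  by rewrite fM gM fu fv.
by rewrite !morph_inv // fu.
Qed.

Lemma mg_kernel_presented k (A : set (Free k)) :
  mg_kernel (presented A) = normal_closure A.
Proof.
rewrite predeqE => w.
rewrite /mg_kernel /= /mg_eval /= -free_eval_unique; first exact: qpi_eq1.
by move=> u v; rewrite qpiM.
Qed.

End Homomorphisms.

(** * Action of the free group on normal forms of BS(m, n) *)

Section NormalFormAction.
Local Open Scope group_scope.
Local Open Scope ring_scope.
Variables (m n : int) (m0 : m != 0) (n0 : n != 0).

(* Letters a and a^-1 are encoded by [false] and [true]; b^(step_mod e)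
   can be moved to the right of the letter e, where it becomes
   b^(step_mod (~~ e)). *)
Definition step_mod (e : bool) : int := if e then m else n.

Definition gs (e : bool) : Free 2 := (if e then ga^-1 else ga)%g.

(* A state (s, z) is a normal form read from right to left: the power b^z
   preceded by the syllables b^r e for (e, r) in s. *)
Definition state : Type := (seq (bool * int) * int)%type.

Definition step (e : bool) (st : state) : state :=
  let q := (st.2 %/ step_mod e)%Z in
  let r := (st.2 %% step_mod e)%Z in
  let st' := ((e, r) :: st.1, step_mod (~~ e) * q) in
  if st.1 is (e', r') :: s then
    if (r == 0) && (e' == ~~ e) then (s, r' + step_mod (~~ e) * q) else st'
  else st'.

Arguments step : simpl never.

(** Normal forms: every exponent is a canonical residue, and a zero exponent never separates two
    inverse letters. *)
Fixpoint ok (s : seq (bool * int)) : bool :=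
  if s is (e, r) :: s' then
    [&& (r %% step_mod e)%Z == r,
      (if s' is (e', _) :: _ then (r == 0) ==> (e' == e) else true) & ok s']
  else true.

Lemma step_mod_neq0 e : step_mod e != 0.
Proof. by case: e. Qed.

Lemma ok_step e st : ok st.1 -> ok (step e st).1.
Proof.
case: st => [[|[e' r'] s] z] /= oks; rewrite /step /=.
  by rewrite modz_mod eqxx.
case: ifPn => [_|]; first by case/and3P: oks.
move=> nc /=; rewrite modz_mod eqxx oks andbT /=.
by apply/implyP => r0; move: nc; rewrite r0 /=; case: (e) (e') => [] [].
Qed.

(** A pushed syllable leaves a multiple of [step_mod (~~ e)], so the inverse letter pops it. A
    popped syllable is recovered since its exponent is a canonical residue, and [ok] excludes a
    second cancellation. *)
Lemma stepK e st : ok st.1 -> step (~~ e) (step e st) = st.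
Proof.
have pn0 := step_mod_neq0.
have push (s : seq (bool * int)) z :
    step (~~ e) ((e, (z %% step_mod e)%Z) :: s, step_mod (~~ e) * (z %/ step_mod e)%Z)
    = (s, z).
  by rewrite /step /= modzMr mulKz // negbK !eqxx /= [RHS]surjective_pairing /=
    addrC mulrC -divz_eq.
case: st => [[|[e' r'] s] z] /= oks; first by rewrite {2}/step /= push.
rewrite {2}/step /=; case: ifPn => [/andP[/eqP z0 /eqP ee]|_]; last by rewrite push.
rewrite {}ee in oks *; case/and3P: oks => /eqP rr top oks.
have qE (q : int) : ((r' + step_mod (~~ e) * q) %/ step_mod (~~ e))%Z = q.
  rewrite addrC mulrC divzMDl //.
  have /eqP := divz_eq r' (step_mod (~~ e)).
  rewrite rr -{1}[r']add0r (inj_eq (addIr r')) eq_sym mulf_eq0 (negbTE (pn0 _)) orbF.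
  by move=> /eqP->; rewrite addr0.
have rE (q : int) : ((r' + step_mod (~~ e) * q) %% step_mod (~~ e))%Z = r'.
  by rewrite addrC mulrC modzMDl.
rewrite /step /= qE rE negbK.
have -> : step_mod e * (z %/ step_mod e)%Z = z.
  by rewrite [RHS](divz_eq z (step_mod e)) z0 addr0 mulrC.
case: s top oks => [//|[e'' r''] s] top oks.
by case: eqP top => //= _ /eqP->; case: (e).
Qed.

Definition act_letter (st : state) (x : letter 'I_2) : state :=
  if x.1 == ord0 then step x.2 st
  else (st.1, st.2 + (if x.2 then -1 else 1)).

Definition act (st : state) (w : Free 2) : state := foldl act_letter st (word w).

Lemma ok_act_letter st x : ok st.1 -> ok (act_letter st x).1.
Proof. by rewrite /act_letter; case: ifP => // _; apply: ok_step. Qed.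

Lemma act_letterK st x : ok st.1 ->
  act_letter (act_letter st x) (letter_inv x) = st.
Proof.
rewrite /act_letter /=; case: (x.1 == ord0) => /= oks; first exact: stepK.
rewrite [RHS]surjective_pairing /=; congr (_, _).
by case: (x.2) => /=; rewrite ?addrNK ?addrK.
Qed.

Lemma ok_foldl st s : ok st.1 -> ok (foldl act_letter st s).1.
Proof. by elim: s st => //= x s IH st oks; apply/IH/ok_act_letter. Qed.

(** Cancellation in the reduced product is harmless, as inverse letters act inversely on [ok]
    states. *)
Lemma foldl_word_mul st u v : ok st.1 ->
  foldl act_letter st (word_mul u v) =
  foldl act_letter (foldl act_letter st u) v.
Proof.
elim: u st => //= x u IH st oks; rewrite -IH; last exact: ok_act_letter.
rewrite -/(word_mul u v); case: (word_mul u v) => //= y s.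
by case: eqP => [->|//]; rewrite act_letterK.
Qed.

Lemma ok_act st w : ok st.1 -> ok (act st w).1.
Proof. exact: ok_foldl. Qed.

Lemma actM st u v : ok st.1 -> act st (u * v)%g = act (act st u) v.
Proof. exact: foldl_word_mul. Qed.

Lemma act_gs st e : act st (gs e) = step e st.
Proof. by case: e. Qed.

Lemma act_gb st z : ok st.1 -> act st (gb ^z z)%g = (st.1, st.2 + z).
Proof.
move=> oks.
have pos k : act st (gb ^+ k)%g = (st.1, st.2 + k%:Z).
  elim: k => [|k IH]; first by rewrite addr0 -surjective_pairing.
  by rewrite expgSr actM // IH /act /= /act_letter /=; congr (_, _); lia.
case: z => k; first exact: pos.
have neg j : act st (gb^-1 ^+ j)%g = (st.1, st.2 - j%:Z).
  elim: j => [|j IH]; first by rewrite subr0 -surjective_pairing.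
  by rewrite expgSr actM // IH /act /= /act_letter /=; congr (_, _); lia.
by rewrite -[(gb ^z Negz k)%g]/(gb ^- k.+1)%g -expVgn neg NegzE.
Qed.

Lemma actK st w : ok st.1 -> act (act st w) w^-1%g = st.
Proof. by move=> oks; rewrite -actM // mulgV. Qed.

(** The words fixing all [ok] states form a normal subgroup, so it is enough to check the defining
    relator. *)
Lemma act_BS_kernel st w : mg_kernel (BS m n) w -> ok st.1 -> act st w = st.
Proof.
rewrite mg_kernel_presented => /(_ [set u | forall st, ok st.1 -> act st u = st]).
move=> /(_ _) h oks; apply: h oks; split.
  split=> [|u v hu st' oks].
    split=> [//|u v hu hv st' oks|u hu st' oks].
      by rewrite actM // hu // hv.
    by rewrite -{1}[st']hu // actK.
  by rewrite !actM // ?ok_act // hu ?ok_act // actK.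
move=> _ -> st' oks.
rewrite -expgzN !actM ?act_gb ?ok_act //.
rewrite -/(gs true) -/(gs false) !act_gs.
(* This is the relation in the form b^n a = a b^m. *)
have E : step false (st'.1, st'.2 + n) = ((step false st').1, (step false st').2 + m).
  rewrite /step /= [in LHS](_ : st'.2 + n = 1 * n + st'.2); last by lia.
  rewrite modzMDl divzMDl //.
  by case: (st'.1) => [|[e' r'] s] /=; [|case: ifP => _ /=]; congr (_, _); ring.
rewrite -E (stepK false) //= addrK.
by rewrite -surjective_pairing.
Qed.

End NormalFormAction.

(** * Britton's lemma for BS(m, n) *)

Section Britton.
Local Open Scope group_scope.
Local Open Scope ring_scope.
Variables (m n : int) (m0 : m != 0) (n0 : n != 0).

(* The syllables are listed from right to left. *)
Fixpoint syllables (l : seq (bool * int)) (z : int) : Free 2 :=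
  (if l is (e, y) :: l' then syllables l' y * gs e * gb ^z z else gb ^z z)%g.

Fixpoint nopinch (l : seq (bool * int)) : bool :=
  if l is (e, y) :: l' then
    (if l' is (e', _) :: _ then (e' == ~~ e) ==> ~~ (step_mod m n e %| y)%Z
     else true) && nopinch l'
  else true.

(** No syllable cancels: the exponent carried by the action differs from [y] by a multiple of
    [step_mod m n (~~ e')], with e' the preceding letter. This modulus is [step_mod m n e] when e'
    and e are inverse, so both exponents pass or fail the divisibility test together. *)
Lemma act_syllables l z : nopinch l ->
  exists s z', [/\ act m n ([::], 0) (syllables l z) = (s, z'),
    map fst s = map fst l &
    (if l is (e, _) :: _ then (step_mod m n (~~ e) %| z' - z)%Z else z' == z)].
Proof.
elim: l z => [|[e y] l IH] z /= => [_|/andP[top /(IH y)[s [y' [sE fs yy']]]]].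
  by exists [::], z; rewrite act_gb // add0r.
have oks : ok m n s.
  by have := @ok_act m n ([::], 0) (syllables l y) isT; rewrite sE.
have E : act m n ([::], 0) (syllables l y * gs e * gb ^z z)%g =
         ((step m n e (s, y')).1, (step m n e (s, y')).2 + z).
  by rewrite !actM ?ok_act // sE act_gs act_gb // ok_step.
have stE : step m n e (s, y') =
    ((e, (y' %% step_mod m n e)%Z) :: s,
     step_mod m n (~~ e) * (y' %/ step_mod m n e)%Z).
  rewrite /step /=; case: s {sE oks E} fs => [//|[e1 r] s].
  case: l {IH} top yy' => [//|[e2 y2] l] /= top yy' [e12 _].
  case: ifP => // /andP[/eqP r0 /eqP e1e]; move: top yy'.
  rewrite -e12 e1e eqxx /= negbK => + yy'.
  have y'0 : (step_mod m n e %| y')%Z by apply/dvdz_mod0P.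
  by rewrite -[y](subKr y') rpredB.
rewrite {}stE in E.
exists ((e, (y' %% step_mod m n e)%Z) :: s),
  (step_mod m n (~~ e) * (y' %/ step_mod m n e)%Z + z).
by split=> //; rewrite /= ?fs // addrK dvdz_mulr.
Qed.

Lemma britton l z : nopinch l -> mg_kernel (BS m n) (syllables l z) ->
  l = [::] /\ z = 0.
Proof.
move=> nl /act_BS_kernel wK.
have [s [z' [sE fs zz']]] := act_syllables z nl.
have := wK m0 n0 ([::], 0) isT; rewrite sE => -[s0 z0].
by move: fs zz'; rewrite s0; case: l {wK nl sE} => //= _; rewrite z0 => /eqP<-.
Qed.

Lemma mg_evalV k (G : markedGroup k) (w : Free k) :
  mg_eval G w^-1%g = ((mg_eval G w)^-1)%g.
Proof. exact/morph_inv/mg_evalM. Qed.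

Lemma mg_evalX k (G : markedGroup k) (w : Free k) z :
  mg_eval G (w ^z z)%g = (mg_eval G w ^z z)%g.
Proof. exact/expgz_morph/mg_evalM. Qed.

Lemma BS_relation :
  (mg_eval (BS m n) ga * mg_eval (BS m n) gb ^z m * (mg_eval (BS m n) ga)^-1
   = mg_eval (BS m n) gb ^z n)%g.
Proof.
have : mg_kernel (BS m n) (ga * gb ^z m * ga^-1 * (gb ^z n)^-1)%g.
  by rewrite mg_kernel_presented; apply: sub_normal_closure.
rewrite /mg_kernel /= !mg_evalM !mg_evalV !mg_evalX => /eqP.
by rewrite mulg_eq1 invgK => /eqP.
Qed.

End Britton.

(** * Polynomial exponents and their behaviour for large n *)

Section Presentation.
Local Open Scope group_scope.
Local Open Scope ring_scope.
Variables (m : int) (m0 : m != 0) (x : nat -> int).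
Hypothesis x0 : forall n, x n != 0.
Hypothesis xoo : forall k, \forall n \near \oo, (k < absz (x n))%N.
Hypothesis xm : forall h, exists r, \forall n \near \oo, (m ^+ h %| x n - r)%Z.

(* The list c_0, .., c_d stands for c_0 + c_1 t + .. + c_d t^d at t = x n / m. *)
Fixpoint ev (P : seq int) (n : nat) : int :=
  if P is c :: P' then c + x n * (ev P' n %/ m)%Z else 0.

(** The values of all proper tails are eventually divisible by m, so the quotients in [ev] are
    exact. *)
Fixpoint integral (P : seq int) : Prop :=
  if P is _ :: P' then
    integral P' /\ \forall n \near \oo, (m %| ev P' n)%Z
  else True.

Fixpoint bpow (P : seq int) : Free 2 :=
  (if P is c :: P' then ga * bpow P' * ga^-1 * gb ^z c else 1)%g.

Fixpoint addp (P Q : seq int) : seq int :=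
  match P, Q with
  | c :: P', d :: Q' => (c + d) :: addp P' Q'
  | [::], _ => Q
  | _, [::] => P
  end.

Lemma integral_addp P Q : integral P -> integral Q ->
  integral (addp P Q) /\
  \forall n \near \oo, ev (addp P Q) n = ev P n + ev Q n.
Proof.
elim: P Q => [|c P IH] [|d Q] //=.
- by move=> _ _; split=> //; near=> n.
- by move=> _ [iQ dQ]; split=> //; near=> n; rewrite add0r.
- by move=> [iP dP] _; split=> //; near=> n; rewrite addr0.
move=> [iP dP] [iQ dQ]; have [iPQ evD] := IH Q iP iQ; split; first split=> //.
  near=> n; have -> : ev (addp P Q) n = ev P n + ev Q n by near: n.
  by apply: rpredD; near: n.
near=> n; have -> : ev (addp P Q) n = ev P n + ev Q n by near: n.
rewrite divzDl; last by near: n.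
ring.
Unshelve. all: by end_near.
Qed.

(** A Horner step divides by m and loses one power of m, so the induction hypothesis is taken at h +
    1. *)
Lemma ev_mod P h : integral P ->
  exists r, \forall n \near \oo, (m ^+ h %| ev P n - r)%Z.
Proof.
elim: P h => [|c P IH] h /=; first by exists 0; near=> n; rewrite subrr dvdz0.
case=> iP dP; have [r rP] := IH h.+1 iP; have [s sx] := xm h.
exists (c + s * (r %/ m)%Z); near=> n.
have [q /eqP] : exists q, ev P n - r = q * m ^+ h.+1.
  by apply/dvdzP; near: n.
rewrite subr_eq => /eqP qE.
have mP : (m %| ev P n)%Z by near: n.
have mr : (m %| r)%Z.
  have -> : r = ev P n - q * m ^+ h * m by rewrite qE exprSr; ring.
  by rewrite rpredB // dvdz_mull.
have [k xE] : exists k, x n - s = k * m ^+ h by apply/dvdzP; near: n.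
have -> : (ev P n %/ m)%Z = q * m ^+ h + (r %/ m)%Z.
  by rewrite qE exprSr mulrA divzMDl.
apply/dvdzP; exists (x n * q + k * (r %/ m)%Z).
have -> : x n = s + k * m ^+ h by rewrite -xE; ring.
ring.
Unshelve. all: by end_near.
Qed.

Lemma integral_dvdz P : integral P ->
  (\forall n \near \oo, (m %| ev P n)%Z) \/
  (\forall n \near \oo, ~~ (m %| ev P n)%Z).
Proof.
move=> /(ev_mod 1)[r]; rewrite expr1 => rP.
have [mr|mr] := boolP (m %| r)%Z; [left|right]; near=> n.
  by rewrite -(subrK r (ev P n)) rpredD //; near: n.
apply: contra mr => mP; rewrite -(subKr (ev P n) r) rpredB //.
by near: n.
Unshelve. all: by end_near.
Qed.

(** Once |x n| exceeds all coefficients, a zero value forces the constant term to vanish, then the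
    value of the tail. With all coefficients zero, [bpow P] collapses in the free group. *)
Lemma ev_eq0 P : integral P ->
  \forall n \near \oo, ev P n = 0 -> bpow P = 1%g.
Proof.
elim: P => [|c P IH] /= => [_|[iP dP]]; first by near=> n.
near=> n => evP.
have cx : (absz c < absz (x n))%N by near: n; exact: xoo.
have c0 : c = 0.
  apply/eqP/contraT => c0; move: cx; rewrite ltnNge => /negP[].
  apply: dvdn_leq; first by rewrite absz_gt0.
  suff : (x n %| c)%Z by [].
  by rewrite -(addrK (x n * (ev P n %/ m)%Z) c) evP sub0r rpredN dvdz_mulr.
move/eqP: evP; rewrite c0 add0r mulf_eq0 (negbTE (x0 n)) /= => /eqP evm.
have mP : (m %| ev P n)%Z by near: n.
have evP0 : ev P n = 0 by rewrite -(divzK mP) evm mul0r.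
suff -> : bpow P = 1%g by rewrite (mulg1 ga) mulgV mul1g.
by move: evP0; near: n; apply: IH.
Unshelve. all: by end_near.
Qed.

(** The value is congruent to c modulo x n, and x n cannot divide c when 0 < |c| < |x n|. *)
Lemma integral_dvdz_base c P : integral (c :: P) ->
  c = 0 \/ \forall n \near \oo, ~~ (x n %| ev (c :: P) n)%Z.
Proof.
move=> [iP dP]; have [->|c0] := eqVneq c 0; [by left|right].
near=> n; have cx : (absz c < absz (x n))%N by near: n; exact: xoo.
rewrite /= rpredDr ?dvdz_mulr // dvdzE; apply/negP => /dvdn_leq.
by rewrite absz_gt0 leqNgt cx => /(_ c0).
Unshelve. all: by end_near.
Qed.

Local Notation B n := (BS m (x n)).

Lemma mg_eval_bpow P : integral P ->
  \forall n \near \oo, mg_eval (B n) (bpow P) = (mg_eval (B n) gb ^z ev P n)%g.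
Proof.
elim: P => [|c P IH] /= => [_|[iP dP]]; first by near=> n; exact: free_eval1.
near=> n; rewrite !mg_evalM mg_evalV mg_evalX.
have -> : mg_eval (B n) (bpow P) = (mg_eval (B n) gb ^z ev P n)%g.
  by near: n; apply: IH.
have mP : (m %| ev P n)%Z by near: n.
rewrite -{1}(divzK mP) mulrC expgzM conj_expgz BS_relation.
by rewrite -expgzM -expgzD addrC.
Unshelve. all: by end_near.
Qed.

Lemma bpow_updown P : bpow P =
  (ga ^+ size P * \prod_(c <- rev P) (ga^-1 * gb ^z c))%g.
Proof.
elim: P => [|c P IH]; first by rewrite big_nil mulg1.
by rewrite rev_cons -cats1 big_cat big_seq1 /= IH expgS !mulgA.
Qed.

(** * Consequences of the relators *)

Local Notation N := (normal_closure (relators m x)).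
Local Notation G := (presented (relators m x)).
Local Notation q := (mg_eval G).

Lemma mg_eval_presented u v : (q u = q v) <-> N (u^-1 * v)%g.
Proof.
rewrite -mg_kernel_presented /mg_kernel /= mg_evalM mg_evalV.
split=> [->|/eqP]; first by rewrite mulVg.
by rewrite mulg_eq1 (inj_eq (@invg_inj _)) => /eqP.
Qed.

Lemma bar_bpow c P : integral (c :: P) ->
  (q (bpow (c :: P)) * q (bar (bpow (c :: P))) = 1)%g.
Proof.
move=> iP; rewrite -mg_evalM.
suff : mg_kernel G (bpow (c :: P) * bar (bpow (c :: P)))%g by [].
rewrite mg_kernel_presented; apply: sub_normal_closure.
exists (bpow (c :: P)) => //; split; last first.
  apply/tree_act_v0; near=> n.
  have -> : mg_eval (BSseq m x n) (bpow (c :: P)) =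
            (mg_eval (B n) gb ^z ev (c :: P) n)%g.
    by near: n; apply: mg_eval_bpow.
  have [g1 gM gV] := generated_subgroup [set mg_eval (B n) gb].
  have gX k : generated [set mg_eval (B n) gb] (mg_eval (B n) gb ^+ k)%g.
    by elim: k => [//|k IH]; rewrite expgSr; apply: gM => //; apply: sub_generated.
  by case: (ev _ _) => k; [exact: gX|apply: gV; exact: gX].
(* The first k exponents are zero, then the coefficients follow from the highest down; [updown]
   numbers them from 1, whence [i.-1]. *)
set k := size (c :: P); exists k, (fun i => nth 0 (nseq k 0 ++ rev (c :: P)) i.-1).
split=> //; rewrite bpow_updown /updown; congr (_ * _)%g.
  rewrite -/k -[in LHS](subnK (leq0n k)) -[(k - 0)%N]/(k.+1 - 1)%N addn0.
  rewrite -prodg_const_nat; apply: eq_big_nat => i /andP[i0 ik].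
  by rewrite nth_cat size_nseq (_ : (i.-1 < k)%N) ?nth_nseq ?if_same ?mulg1 //; lia.
rewrite (big_nth 0) size_rev -/k.
rewrite -[k.+1]add0n big_addn (_ : ((2 * k).+1 - k.+1)%N = k); last by lia.
apply: eq_big_nat => i /andP[_ ik].
rewrite nth_cat size_nseq (_ : ((i + k.+1).-1 < k)%N = false); last by lia.
by congr (_ * _ ^z nth _ _ _)%g; lia.
Unshelve. all: by end_near.
Qed.

Lemma barM : {morph bar : u v / (u * v)%g}.
Proof. exact: free_evalM. Qed.

Lemma bar_gb z : bar (gb ^z z)%g = (gb ^z (- z))%g.
Proof.
by rewrite (expgz_morph _ _ barM) {1}/bar free_eval_gen -{1}[(gb^-1)%g]/(gb ^z (-1))%g
  -expgzM mulN1r.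
Qed.

(** [bar] turns the defining relator into a b^(-m') a^-1 b^n, which is again trivial, so it induces
    an endomorphism of the group that inverts b. *)
Lemma mg_eval_bar m' n w z :
  (mg_eval (BS m' n) w = mg_eval (BS m' n) gb ^z z)%g ->
  (mg_eval (BS m' n) (bar w) = mg_eval (BS m' n) gb ^z (- z))%g.
Proof.
pose ev' := mg_eval (BS m' n).
have barR : (bar (ga * gb ^z m' * ga^-1 * (gb ^z n)^-1) =
             ga * gb ^z (- m') * ga^-1 * gb ^z n)%g.
  have -> : ga^-1%g = gs true by [].
  have barG e : bar (gs e) = gs e.
    by case: e; rewrite ?(morph_inv barM) /bar free_eval_gen.
  by rewrite -expgzN !barM !bar_gb opprK -[ga]/(gs false) !barG.
have barN u : mg_kernel (BS m' n) u -> ev' (bar u) = 1%g.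
  rewrite mg_kernel_presented; move: u.
  apply: (@normal_closure_min _ _ [set u | ev' (bar u) = 1%g]).
    by apply: (@kernel_normal _ _ (ev' \o bar)) => u v /=; rewrite barM /ev' mg_evalM.
  move=> _ ->; rewrite /= barR /ev' !mg_evalM mg_evalV !mg_evalX.
  by rewrite -mulrN1 expgzM conj_expgz BS_relation -expgzM -expgzD mulrN1 addNr.
move=> wE; have : ev' (bar (w * gb ^z (- z)))%g = 1%g.
  by apply: barN; rewrite /mg_kernel /= mg_evalM mg_evalX wE -expgzD addrN.
rewrite barM bar_gb opprK /ev' mg_evalM mg_evalX expgzN => /eqP.
by rewrite mulg_eq1 => /eqP.
Qed.

Lemma bpow_addc c d P : bpow (c + d :: P) = (bpow (c :: P) * gb ^z d)%g.
Proof. by rewrite /= expgzD mulgA. Qed.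

(** With u = [bpow (c :: P)], the relators for c and c + z read u bar(u) = 1 and u b^z bar(u) b^(-z)
    = 1; eliminate bar(u). *)
Lemma bpow_comm c P z : integral (c :: P) ->
  (q (bpow (c :: P)) * q gb ^z z = q gb ^z z * q (bpow (c :: P)))%g.
Proof.
move=> iP; have /eqP := bar_bpow iP; have : integral (c + z :: P) by [].
move=> /bar_bpow; rewrite bpow_addc barM bar_gb !mg_evalM !mg_evalX expgzN.
rewrite !mulg_eq1 => /eqP + /eqP h'; rewrite h'.
by rewrite mulg_eq1 invgM invgK => /eqP.
Qed.

(** Moving b^c past [bpow (d :: Q)] brings a^-1 next to a, and the inner factors merge by
    induction. *)
Lemma bpow_addp P Q : integral P -> integral Q ->
  q (bpow (addp P Q)) = (q (bpow P) * q (bpow Q))%g.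
Proof.
have q1 : q 1%g = 1%g by exact: free_eval1.
elim: P Q => [|c P IH] [|d Q] iP iQ; rewrite ?q1 ?mul1g ?mulg1 //.
have := bpow_comm c iQ.
rewrite /= !mg_evalM IH //; last by case: iQ.
  rewrite !mg_evalV !mg_evalX => h.
  set a := q ga in h *; set b := q gb in h *.
  by rewrite -!mulgA in h *; rewrite -h mulKg -expgzD [d + c]addrC.
by case: iP.
Qed.

(** Conjugating by a multiplies the polynomial by t, which stays integral if m divides the values;
    conjugating by a^-1 divides it by t, which is possible if the constant term is zero. *)
Lemma conj_bpow e P : integral P ->
  (exists P', integral P' /\ q (gs (~~ e) * bpow P * gs e)%g = q (bpow P')) \/
  \forall n \near \oo, ~~ (step_mod m (x n) e %| ev P n)%Z.
Proof.
case: e => iP /=.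
  have [dP|] := integral_dvdz iP; [left|by right].
  by exists (0 :: P); split; rewrite //= (mulg1 (_ * _)%g).
case: P iP => [|c P] iP; [left|].
  by exists [::]; split; rewrite // mulg1 mulVg.
have [c0|] := integral_dvdz_base iP; [left|by right].
exists P; split; first by case: iP.
by rewrite c0 /= (mulg1 (_ * _)%g) !mulgA mulVg mul1g mulgVK.
Qed.

(** * Britton reduction modulo the relators, uniformly in n *)

Fixpoint words (l : seq (bool * seq int)) (P : seq int) : Free 2 :=
  (if l is (e, Q) :: l' then words l' Q * gs e * bpow P else bpow P)%g.

Fixpoint irreducible (l : seq (bool * seq int)) : Prop :=
  if l is (e, Q) :: l' then
    [/\ integral Q,
        (if l' is (e', _) :: _ then
           e' = ~~ e ->
           \forall n \near \oo, ~~ (step_mod m (x n) e %| ev Q n)%Z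
         else True)
      & irreducible l']
  else True.

Lemma words_addp l Q P : integral Q -> integral P ->
  q (words l (addp Q P)) = (q (words l Q) * q (bpow P))%g.
Proof.
move=> iQ iP; case: l => [|[e Q'] l] /=; first exact: bpow_addp.
by rewrite !mg_evalM bpow_addp // !mulgA.
Qed.

Definition normalizes (v : Free 2) : Prop := forall l P,
  irreducible l -> integral P -> exists l' P',
  [/\ irreducible l', integral P' & q (words l P * v)%g = q (words l' P')].

(** Either the letter is appended, or it forms a pinch with the last one; the pinch then becomes a
    polynomial power of b, absorbed by the preceding exponent. *)
Lemma normalizes_gs e : normalizes (gs e).
Proof.
move=> l P il iP.
have push : (if l is (e', _) :: _ then
               e' = ~~ e ->
               \forall n \near \oo, ~~ (step_mod m (x n) e %| ev P n)%Z
             else True) ->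
    exists l' P', [/\ irreducible l', integral P' &
      q (words l P * gs e)%g = q (words l' P')].
  by move=> np; exists ((e, P) :: l), [::]; split; rewrite /= ?mulg1.
case: l il push => [|[e' Q] l] il push; first exact: push.
have [ee|ee] := eqVneq e' (~~ e); last by apply: push => /eqP; rewrite (negbTE ee).
have [[P' [iP' PP']]|np] := conj_bpow e iP; last exact: push.
case: il => iQ _ il; exists l, (addp Q P'); split=> //.
  by have [] := integral_addp iQ iP'.
by rewrite words_addp // -PP' -mg_evalM ee /= !mulgA.
Qed.

Lemma normalizes_gb z : normalizes (gb ^z z)%g.
Proof.
move=> l P il iP; have iz : integral [:: z] by split=> //=; near=> n; exact: dvdz0.
exists l, (addp P [:: z]); split=> //; first by have [] := integral_addp iP iz.
have -> : (gb ^z z)%g = bpow [:: z] by rewrite /= (mulg1 ga) mulgV mul1g.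
by rewrite words_addp // mg_evalM.
Unshelve. all: by end_near.
Qed.

(** The property is not visibly stable under inversion, so u and u^-1 are treated together to obtain
    a subgroup. *)
Lemma normalizes_all v : normalizes v.
Proof.
suff : generated (range (@free_gen 'I_2)) v ->
       [set u | normalizes u /\ normalizes u^-1%g] v.
  by rewrite free_generated => -[].
apply; split; last first.
  move=> _ [i _ <-] /=.
  have [i0|i1] : i = ord0 \/ i = ord_max.
    by case: i => [[|[|i]] ltin] //; [left|right]; apply: val_inj.
    by rewrite i0; split;
      [exact: (normalizes_gs false)|exact: (normalizes_gs true)].
  by rewrite i1; split; [exact: (normalizes_gb 1)|exact: (normalizes_gb (-1))].
have nM u w : normalizes u -> normalizes w -> normalizes (u * w)%g.
  move=> nu nw l P il iP; have [l1 [P1 [il1 iP1 E1]]] := nu _ _ il iP.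
  have [l2 [P2 [il2 iP2 E2]]] := nw _ _ il1 iP1; exists l2, P2; split=> //.
  by rewrite -E2 mulgA !(mg_evalM _ _ w) E1.
split=> /= [|u w [nu nu'] [nw nw']|u [nu nu']].
- by rewrite invg1; split=> l P il iP; exists l, P; rewrite mulg1.
- by rewrite invgM; split; apply: nM.
- by rewrite invgK.
Qed.

(** * Comparison with the kernels of BS(m, x n) for large n *)

Lemma mg_eval_words l P : irreducible l -> integral P ->
  \forall n \near \oo, mg_eval (B n) (words l P) =
    mg_eval (B n) (syllables [seq (i.1, ev i.2 n) | i <- l] (ev P n)).
Proof.
elim: l P => [|[e Q] l IH] P /=.
  by move=> _ /mg_eval_bpow; apply: filterS => n; rewrite mg_evalX.
case=> iQ _ il iP; near=> n; rewrite !mg_evalM mg_evalX.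
by congr (_ * _ * _)%g; near: n; [apply: IH|apply: mg_eval_bpow].
Unshelve. all: by end_near.
Qed.

Lemma irreducible_nopinch l : irreducible l ->
  \forall n \near \oo, nopinch m (x n) [seq (i.1, ev i.2 n) | i <- l].
Proof.
elim: l => [|[e Q] l IH] /=; first by move=> _; near=> n.
case=> iQ top il; near=> n; apply/andP; split; last by near: n; apply: IH.
near: n; case: l top {IH il} => [|[e' Q'] l] /= top; first by near=> n.
have [ee|ee] := eqVneq e' (~~ e); last by near=> n.
exact: top.
Unshelve. all: by end_near.
Qed.

(** An element fixing v0 is, for large n, a power b^z, and [bar] sends it to b^(-z). *)
Lemma normal_closure_near w : N w -> \forall n \near \oo, mg_kernel (B n) w.
Proof.
move: w; apply: (@normal_closure_min _ _
  [set w | \forall n \near \oo, mg_kernel (B n) w]).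
  split=> [|u v /= nu]; last first.
    apply: filterS nu => n; rewrite /mg_kernel /= !mg_evalM mg_evalV => ->.
    by rewrite mulg1 mulgV.
  split=> /= [|u v nu nv|u nu].
  - by near=> n; exact: free_eval1.
  - near=> n; rewrite /mg_kernel /= mg_evalM.
    rewrite (_ : mg_eval (B n) u = 1%g); last by near: n.
    by rewrite mul1g; near: n.
  - by apply: filterS nu => n; rewrite /mg_kernel /= mg_evalV => ->; rewrite invg1.
move=> _ [w [_ /tree_act_v0 wv] <-] /=; near=> n.
have [z _ zE] : range (fun z => mg_eval (B n) gb ^z z)%g (mg_eval (B n) w).
  by apply: generated_set1; near: n.
by rewrite /mg_kernel /= mg_evalM (mg_eval_bar (esym zE)) -zE expgzN mulgV.
Unshelve. all: by end_near.
Qed.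

(** Modulo the relators, w is an irreducible word. If it were trivial for a single large n,
    Britton's lemma would leave only [bpow P] with value 0, which is 1 in the free group, so w would
    lie in the normal closure. *)
Lemma near_mg_kernel w :
  \forall n \near \oo, mg_kernel (B n) w <-> N w.
Proof.
have [Nw|nNw] := pselect (N w).
  by apply: filterS (normal_closure_near Nw).
have [l [P [il iP]]] := @normalizes_all w [::] [::] I I.
rewrite mul1g => /[dup] wE /mg_eval_presented /normal_closure_near nE.
near=> n; split=> // wn; exfalso.
have : mg_kernel (B n) (words l P).
  have : mg_kernel (B n) (w^-1 * words l P)%g by near: n.
  by rewrite /mg_kernel /= mg_evalM mg_evalV wn invg1 mul1g.
rewrite /mg_kernel /=.
have -> : mg_eval (B n) (words l P) =
    mg_eval (B n) (syllables [seq (i.1, ev i.2 n) | i <- l] (ev P n)).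
  by near: n; apply: mg_eval_words.
have np : nopinch m (x n) [seq (i.1, ev i.2 n) | i <- l].
  by near: n; apply: irreducible_nopinch.
move=> /(britton m0 (x0 n) np)[l0 P0]; apply: nNw.
have P1 : bpow P = 1%g by move: P0; near: n; apply: ev_eq0.
rewrite -mg_kernel_presented /mg_kernel /= wE.
have -> : words l P = bpow P by case: (l) l0.
by rewrite P1; exact: free_eval1.
Unshelve. all: by end_near.
Qed.

End Presentation.

(** * Convergence of marked groups and independence of the sequence *)

Section Limits.
Local Open Scope ring_scope.

Lemma filter_forall_words (T : finType) (I : Type) (F : set_system I)
    (FF : Filter F) (P : seq T -> I -> Prop) (L : nat) :
  (forall w, \forall i \near F, P w i) ->
  \forall i \near F, forall w, (size w < L)%N -> P w i.
Proof.
move=> FP.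
have : \forall i \near F, forall (k : 'I_L) (t : k.-tuple T), P t i.
  by apply: filter_forall => k; apply: filter_forall.
by apply: filterS => i Pi w wL; apply: (Pi (Ordinal wL) (in_tuple w)).
Qed.

(** A distance below e^(-|w|) prevents w from distinguishing the groups; conversely, only finitely
    many words are shorter than a given L, so they can be handled simultaneously. *)
Lemma mg_cvgP (R : realType) k (u : nat -> markedGroup k) (G : markedGroup k) :
  mg_cvg R u G <->
  forall w, \forall n \near \oo, mg_kernel (u n) w <-> mg_kernel G w.
Proof.
split=> [/cvgr0Pnorm_lt uG w|uG].
  have := uG (expR (- (size (word w))%:R)) (expR_gt0 _).
  apply: filterS => n; apply: contraPP => uw; apply/negP; rewrite -leNgt.
  rewrite /mg_dist; case: pselect => [h|[]]; last first.
    by exists (size (word w)); apply/asboolP; exists w.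
  rewrite ger0_norm ?expR_ge0 // ler_expR lerN2 ler_nat.
  by case: ex_minnP => j _; apply; apply/asboolP; exists w.
apply/cvgr0Pnorm_le => e e0.
have [L Le] : exists L : nat, expR (- L%:R) <= e.
  (* This L exceeds 1/e, and exp(L) >= 1 + L. *)
  exists (Num.truncn e^-1).+1; rewrite expRN invf_ple ?posrE ?expR_gt0 //.
  apply: (le_trans (ltW (truncnS_gt _))).
  by apply: le_trans (expR_ge1Dx _); rewrite lerDr.
have : \forall n \near \oo, forall s : seq (letter 'I_k), (size s < L)%N ->
    forall r : reduced s, mg_kernel (u n) (FreeElt r) <-> mg_kernel G (FreeElt r).
  apply: (@filter_forall_words ('I_k * bool)%type) => s.
  have [r|nr] := pselect (reduced s); last by near=> n => r; case: nr.
  by have := uG (FreeElt r); apply: filterS => n h r'; rewrite (bool_irrelevance r' r).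
apply: filterS => n h; rewrite /mg_dist; case: pselect => [h'|_]; last first.
  by rewrite normr0 ltW.
rewrite ger0_norm ?expR_ge0 //; apply: le_trans Le; rewrite ler_expR lerN2 ler_nat.
case: ex_minnP => j /asboolP[[s r] sj nE] _; rewrite leqNgt; apply/negP => jL.
by apply: nE; apply: h; rewrite sj.
Unshelve. all: by end_near.
Qed.

Section Admissible.
Variables (m : int) (m0 : m != 0) (xi : madic m).

Lemma admissible_near_mg_kernel x w : admissible xi x ->
  \forall n \near \oo,
    mg_kernel (BS m (x n)) w <-> normal_closure (relators m x) w.
Proof.
case=> x0 /cvgnyPgt xoo xm; apply: near_mg_kernel => // h.
exists (xi h); apply: filterS (xm h) => n <-.
rewrite {1}(divz_eq (x n) (m ^+ h)) addrK dvdz_mull //.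
Qed.

Lemma admissible_interleave x y : admissible xi x -> admissible xi y ->
  admissible xi (fun n => if odd n then y n./2 else x n./2).
Proof.
have near2 (P Q : nat -> Prop) :
    (\forall n \near \oo, P n) -> (\forall n \near \oo, Q n) ->
    \forall n \near \oo, if odd n then Q n./2 else P n./2.
  move=> [N1 _ N1P] [N2 _ N2Q]; exists (maxn N1 N2).*2 => // n /= nN.
  by case: ifP => _; [apply: N2Q|apply: N1P] => /=; lia.
case=> x0 /cvgnyPgt xoo xm [y0 /cvgnyPgt yoo ym]; split.
- by move=> n; case: ifP.
- apply/cvgnyPgt => A; apply: filterS (near2 _ _ (xoo A) (yoo A)) => n.
  by case: ifP.
- by move=> h; apply: filterS (near2 _ _ (xm h) (ym h)) => n; case: ifP.
Qed.

Lemma normal_closure_relators x y : admissible xi x -> admissible xi y ->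
  normal_closure (relators m x) = normal_closure (relators m y).
Proof.
move=> ax ay; rewrite predeqE => w.
have := admissible_near_mg_kernel w (admissible_interleave ax ay).
move=> [N0 _ zE].
have [N1 _ xE] := admissible_near_mg_kernel w ax.
have [N2 _ yE] := admissible_near_mg_kernel w ay.
set N := maxn N0 (maxn N1 N2).
(* The interleaved sequence takes the values x N and y N at these indices, so its normal closure
   agrees on w with both others. *)
have /= := zE N.*2; have /= := zE N.*2.+1.
rewrite odd_double /= uphalf_double doubleK.
have -> := xE N; last by rewrite /=; lia.
have -> := yE N; last by rewrite /=; lia.
by move=> <-; [move=> <- //|]; lia.
Qed.

End Admissible.

End Limits.

(** * The presentation of the limit *)

Local Open Scope ring_scope.

Theorem theorem4p4 (R : realType) (m : int) (hm : m != 0) (xi : madic m)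
    (x : nat -> int) (hx : admissible xi x) :
  admits_presentation (BSbar R xi) (relators m x).
Proof.
have lim : is_BS_limit R xi (presented (relators m x)).
  move=> y ay; apply/mg_cvgP => w; rewrite mg_kernel_presented.
  rewrite (normal_closure_relators hm hx ay).
  exact: (admissible_near_mg_kernel hm w ay).
(* The default value in [BSbar] is excluded by [lim]. *)
rewrite /admits_presentation /BSbar; case: pselect => [h|[]]; last by eexists; exact: lim.
case: (cid h) => G /= Glim; rewrite predeqE => w.
(* The limit chosen by [cid] is arbitrary, but at a common large n its kernel and the normal closure
   both agree on w with the kernel of BS(m, x n). *)
have [n [GE <-]] := @filter_ex _ \oo%classic _ _ (filterI
   (proj1 (mg_cvgP _ _ _) (Glim _ hx) w) (admissible_near_mg_kernel hm w hx)).
by symmetry.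
Qed.
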